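(* Let $C\in\mathbb{R}^{p\times q}$ be a matrix of full column rank, let $\mathcal{E}=\{Cs : s\in\mathbb{R}^q,\ \|s\|=1\}$, let $f_0\in\mathcal{E}$, and let $\{f_k\}_{k\ge0}\subset\mathcal{E}$ be the sequence produced by the tangent-space/retraction iteration on $\mathcal{E}$ started at $f_0$. Put $s_k=C^+f_k$. Then for every $k\ge 0$, with $\beta_k=1/\|(C^TC)^{-1}s_k\|$, $$s_{k+1}=\beta_k\,(C^TC)^{-1}s_k,\qquad f_{k+1}=\beta_k\,(CC^T)^+f_k .$$ That is, $\{s_k\}$ is a sequence of the normalized inverse power method for $C^TC$, and $\{f_k\}$ is a properly normalized sequence of the power method for $(CC^T)^+$.
   Context: Norms are Euclidean; $M^+$ denotes the Moore--Penrose inverse of $M$. Retraction: for a nonzero $z\in\mathrm{Range}(C)$ there is a unique $y\in\mathcal{E}$ with $z=\alpha y$ for some scalar $\alpha>0$; this $y$ is called the retraction of $z$ onto $\mathcal{E}$. Tangent space: for $f=Cs\in\mathcal{E}$ with $\|s\|=1$, the (affine, $(q-1)$-dimensional) tangent space of $\mathcal{E}$ at $f$ is $\mathcal{T}_f=\{f+Cw : w\in\mathbb{R}^q,\ s^Tw=0\}$. Iteration: choose $f_0\in\mathcal{E}$; for $k=0,1,2,\dots$ let $z_k$ be the minimum (Euclidean) norm vector in $\mathcal{T}_{f_k}$, and let $f_{k+1}$ be the retraction of $z_k$ onto $\mathcal{E}$. *)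

(* Defs.v *)
From mathcomp Require Import all_boot all_order all_algebra.
From mathcomp Require Import classical_sets reals.

Set Implicit Arguments.
Unset Strict Implicit.
Unset Printing Implicit Defensive.

Import Order.TTheory GRing.Theory Num.Theory.
Local Open Scope ring_scope.
Local Open Scope classical_set_scope.

Definition enorm (R : realType) n (v : 'cV[R]_n) : R :=
  Num.sqrt (\sum_(i < n) v i 0 ^+ 2).

(* The four Penrose equations; over the reals the conjugate transpose is ^T. *)
Definition penrose (R : realType) m n (A : 'M[R]_(m, n)) (X : 'M[R]_(n, m)) :
    bool :=
  [&& A *m X *m A == A, X *m A *m X == X,
      (A *m X)^T == A *m X & (X *m A)^T == X *m A].

Lemma row_free_gram_unit (R : realType) m n (A : 'M[R]_(m, n)) :
  row_free A -> A *m A^T \in unitmx.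
Proof.
move=> fA; rewrite -row_free_unit; apply: inj_row_free => v vAA0.
apply: (row_free_inj fA); rewrite mul0mx.
have : ((v *m A) *m (v *m A)^T) 0 0 = 0.
  by rewrite trmx_mul mulmxA -(mulmxA v) vAA0 mul0mx mxE.
rewrite mxE => /eqP; rewrite psumr_eq0 => [/allP v0|i _]; last first.
  by rewrite [(_^T) _ _]mxE -expr2 sqr_ge0.
apply/rowP => j; rewrite [RHS]mxE; apply/eqP.
have := v0 j; rewrite mem_index_enum => /(_ isT).
by rewrite [(_^T) _ _]mxE mulf_eq0 orbb.
Qed.

Lemma penrose_ex (R : realType) m n (A : 'M[R]_(m, n)) :
  exists X : 'M[R]_(n, m), penrose A X.
Proof.
move: (mulmx_base A) (row_base_free A) (col_base_full A).
move: (row_base A) (col_base A); move: (\rank A) => r K L <- fK fL.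
have uK : K *m K^T \in unitmx by apply: row_free_gram_unit.
have uL : L^T *m L \in unitmx.
  by rewrite -{2}[L]trmxK; apply: row_free_gram_unit; rewrite /row_free mxrank_tr.
pose G := invmx (K *m K^T); pose H := invmx (L^T *m L).
exists (K^T *m G *m H *m L^T).
have GT : G^T = G by rewrite trmx_inv trmx_mul trmxK.
have HT : H^T = H by rewrite trmx_inv trmx_mul trmxK.
have AX : L *m K *m (K^T *m G *m H *m L^T) = L *m H *m L^T.
  rewrite -!mulmxA [K *m (K^T *m _)]mulmxA [K *m K^T *m (G *m _)]mulmxA.
  by rewrite mulmxV // mul1mx.
have XA : K^T *m G *m H *m L^T *m (L *m K) = K^T *m G *m K.
  rewrite -!mulmxA [L^T *m (L *m _)]mulmxA [H *m (L^T *m L *m _)]mulmxA.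
  by rewrite mulVmx // mul1mx.
apply/and4P; split; apply/eqP.
- by rewrite AX mulmxA -(mulmxA _ L^T) -(mulmxA L H) mulVmx // mulmx1.
- rewrite XA -!mulmxA [K *m (K^T *m _)]mulmxA [K *m K^T *m (G *m _)]mulmxA.
  by rewrite mulmxV // mul1mx.
- by rewrite AX !trmx_mul trmxK HT mulmxA.
- by rewrite XA !trmx_mul trmxK GT mulmxA.
Qed.

Lemma penrose_inj (R : realType) m n (A : 'M[R]_(m, n)) (X Y : 'M[R]_(n, m)) :
  penrose A X -> penrose A Y -> X = Y.
Proof.
move=> /and4P[/eqP X1 /eqP X2 /eqP X3 /eqP X4].
move=> /and4P[/eqP Y1 /eqP Y2 /eqP Y3 /eqP Y4].
have AXY : A *m X = A *m Y.
  by rewrite -X3 -{1}Y1 -mulmxA trmx_mul X3 Y3 mulmxA X1.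
have XYA : X *m A = Y *m A.
  by rewrite -X4 -{1}Y1 -mulmxA mulmxA trmx_mul X4 Y4 -mulmxA (mulmxA A) X1.
by rewrite -X2 XYA -mulmxA AXY mulmxA Y2.
Qed.

(* The Moore--Penrose inverse: the unique matrix satisfying [penrose A]. *)
Definition pinv (R : realType) m n (A : 'M[R]_(m, n)) : 'M[R]_(n, m) :=
  xchoose (penrose_ex A).

Lemma pinvP (R : realType) m n (A : 'M[R]_(m, n)) : penrose A (pinv A).
Proof. exact: xchooseP. Qed.

Definition ellipsoid (R : realType) p q (C : 'M[R]_(p, q)) : set 'cV[R]_p :=
  [set C *m s | s in [set s : 'cV[R]_q | enorm s = 1]].

(* When C has full column rank, the unit vector s with f = C s is unique. *)
Definition tangent_space (R : realType) p q (C : 'M[R]_(p, q)) (f : 'cV[R]_p) :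
    set 'cV[R]_p :=
  [set z | exists s w : 'cV[R]_q,
     [/\ enorm s = 1, f = C *m s, s^T *m w = 0 & z = f + C *m w]].

Definition min_norm_vector (R : realType) p (T : set 'cV[R]_p) (z : 'cV[R]_p) :
    Prop :=
  T z /\ forall y, T y -> enorm z <= enorm y.

(* When C has full column rank, this forces z to be a nonzero vector of the
   range of C, which is where the retraction is defined. *)
Definition is_retraction (R : realType) p q (C : 'M[R]_(p, q))
    (z y : 'cV[R]_p) : Prop :=
  ellipsoid C y /\ exists2 alpha : R, 0 < alpha & z = alpha *: y.

Definition tangent_retraction_seq (R : realType) p q (C : 'M[R]_(p, q))
    (f0 : 'cV[R]_p) (f : nat -> 'cV[R]_p) : Prop :=
  f 0%N = f0 /\
  forall k, exists2 z, min_norm_vector (tangent_space C (f k)) z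
                     & is_retraction C z (f k.+1).

(* Main.v *)
Require Import Defs.
From mathcomp Require Import all_boot all_order all_algebra.
From mathcomp Require Import classical_sets reals.

(** Writing [z = C v], the tangent space at [C s] is [{C v | s^T v = 1}].  With
    [u = (C^T C)^-1 s] one has [(C v)^T (C u) = v^T s], so by Pythagoras its
    minimum norm vector is [C u / (s^T u)].  Its retraction is the multiple of
    [C u] whose coefficient vector is a unit vector, namely [C u / |u|]. *)

Set Implicit Arguments.
Unset Strict Implicit.
Unset Printing Implicit Defensive.

Import Order.TTheory GRing.Theory Num.Theory.

Local Open Scope ring_scope.

Lemma enorm_ge0 (R : realType) n (v : 'cV[R]_n) : 0 <= enorm v.
Proof. exact: sqrtr_ge0. Qed.

Lemma sqr_enorm (R : realType) n (v : 'cV[R]_n) :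
  enorm v ^+ 2 = (v^T *m v) 0 0.
Proof.
rewrite sqr_sqrtr; last by apply: sumr_ge0 => i _; exact: sqr_ge0.
by rewrite mxE; apply: eq_bigr => i _; rewrite [(_^T) _ _]mxE expr2.
Qed.

Lemma enormZ (R : realType) n (a : R) (v : 'cV[R]_n) :
  enorm (a *: v) = `|a| * enorm v.
Proof.
rewrite /enorm -sqrtr_sqr -sqrtrM ?sqr_ge0 // mulr_sumr; congr (Num.sqrt _).
by apply: eq_bigr => i _; rewrite mxE exprMn.
Qed.

Lemma enorm0 (R : realType) n : enorm (0 : 'cV[R]_n) = 0.
Proof. by rewrite -[0 in LHS](scale0r 0) enormZ normr0 mul0r. Qed.

Lemma enorm_eq0 (R : realType) n (v : 'cV[R]_n) : (enorm v == 0) = (v == 0).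
Proof.
apply/eqP/eqP => [v0|->]; last exact: enorm0.
have := sqr_enorm v; rewrite v0 expr0n mxE => /esym/eqP.
rewrite psumr_eq0 => [/allP vi0|i _]; last first.
  by rewrite [(_^T) _ _]mxE -expr2 sqr_ge0.
apply/colP => i; rewrite [RHS]mxE; apply/eqP.
by have := vi0 i (mem_index_enum i); rewrite [(_^T) _ _]mxE mulf_eq0 orbb.
Qed.

Lemma sqr_enormD_orth (R : realType) n (u v : 'cV[R]_n) :
  u^T *m v = 0 -> enorm (u + v) ^+ 2 = enorm u ^+ 2 + enorm v ^+ 2.
Proof.
move=> uv0; have vu0 : v^T *m u = 0 by rewrite -[u]trmxK -trmx_mul uv0 trmx0.
by rewrite !sqr_enorm [(u + v)^T]linearD /= mulmxDl !mulmxDr uv0 vu0 addr0 add0r mxE.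
Qed.

Section FullColumnRank.

Variables (R : realType) (p q : nat) (C : 'M[R]_(p, q)).
Hypothesis rankC : \rank C = q.

Let A := C^T *m C.

Lemma gram_unit : A \in unitmx.
Proof.
rewrite /A -{2}[C]trmxK row_free_gram_unit //.
by rewrite /row_free mxrank_tr rankC.
Qed.

Lemma trmx_invmx_gram : (invmx A)^T = invmx A.
Proof. by rewrite trmx_inv trmx_mul trmxK. Qed.

Lemma pinv_full_col : pinv C = invmx A *m C^T.
Proof.
have XC : invmx A *m C^T *m C = 1%:M by rewrite -mulmxA mulVmx ?gram_unit.
apply: (@penrose_inj _ _ _ C); first exact: pinvP.
apply/and4P; split; apply/eqP.
- by rewrite -mulmxA XC mulmx1.
- by rewrite XC mul1mx.
- by rewrite !trmx_mul trmxK trmx_invmx_gram mulmxA.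
- by rewrite XC trmx1.
Qed.

Lemma pinv_full_colK : pinv C *m C = 1%:M.
Proof. by rewrite pinv_full_col -mulmxA mulVmx ?gram_unit. Qed.

Lemma mulmx_full_col_inj n : injective (fun v : 'M[R]_(q, n) => C *m v).
Proof.
move=> v w /(congr1 (mulmx (pinv C))).
by rewrite !mulmxA pinv_full_colK !mul1mx.
Qed.

(** Multiplying the right-hand side by [C *m C^T] on either side gives the same matrix
    [C *m invmx A *m C^T], the orthogonal projector onto the range of [C]. It is symmetric and fixes
    [C], which yields all four Penrose equations. *)
Lemma pinv_mulmx_tr : pinv (C *m C^T) = C *m invmx A *m invmx A *m C^T.
Proof.
set B := invmx A.
have CX : C *m C^T *m (C *m B *m B *m C^T) = C *m B *m C^T.
  by rewrite -!mulmxA (mulmxA C^T) (mulmxA _ B) mulmxV ?gram_unit ?mul1mx.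
have XC : C *m B *m B *m C^T *m (C *m C^T) = C *m B *m C^T.
  by rewrite -!mulmxA (mulmxA C^T) (mulmxA B A) mulVmx ?gram_unit ?mul1mx.
have sym : (C *m B *m C^T)^T = C *m B *m C^T.
  by rewrite !trmx_mul trmxK trmx_invmx_gram mulmxA.
have BA : B *m C^T *m C = 1%:M by rewrite -mulmxA mulVmx ?gram_unit.
apply: (@penrose_inj _ _ _ (C *m C^T)); first exact: pinvP.
apply/and4P; split; apply/eqP; rewrite ?CX ?XC ?sym //.
- by rewrite mulmxA -(mulmxA C B) -(mulmxA C _ C) BA mulmx1.
- by rewrite !mulmxA -(mulmxA C B) -(mulmxA C _ C) BA mulmx1.
Qed.

(** This turns orthogonality to [C *m (invmx A *m s)] among the vectors [C *m v] into orthogonality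
    of [v] to [s], the condition that defines tangent directions. *)
Lemma mulmx_gram_inv (v s : 'cV[R]_q) :
  (C *m v)^T *m (C *m (invmx A *m s)) = v^T *m s.
Proof.
by rewrite trmx_mul -mulmxA (mulmxA C^T) (mulmxA _ (invmx A)) mulmxV ?gram_unit
  ?mul1mx.
Qed.

(** With [u = invmx A *m s] the quantity is the squared norm of [C *m u], and [C *m u] vanishes only
    if [u], hence [s = A *m u], does. *)
Lemma tr_gram_inv_gt0 (s : 'cV[R]_q) : s != 0 -> 0 < (s^T *m (invmx A *m s)) 0 0.
Proof.
move=> s0; set u := invmx A *m s.
have -> : (s^T *m u) 0 0 = enorm (C *m u) ^+ 2.
  by rewrite sqr_enorm mulmx_gram_inv -[s in RHS]trmxK -trmx_mul [RHS]mxE.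
rewrite exprn_gt0 // lt_def enorm_ge0 enorm_eq0 andbT.
apply: contra s0 => /eqP Cu0; apply/eqP.
have u0 : u = 0 by apply: mulmx_full_col_inj; rewrite Cu0 mulmx0.
by rewrite -[s]mul1mx -(mulmxV gram_unit) -mulmxA -/u u0 mulmx0.
Qed.

Lemma min_norm_tangent_space (s : 'cV[R]_q) (z : 'cV[R]_p) :
    enorm s = 1 -> min_norm_vector (tangent_space C (C *m s)) z ->
  exists2 c : R, 0 < c & z = c *: (C *m (invmx A *m s)).
Proof.
move=> s1 [[s' [w [_ /mulmx_full_col_inj <- sw0 zE]]] zmin].
set u := invmx A *m s; pose g := (s^T *m u) 0 0.
have s_neq0 : s != 0 by rewrite -enorm_eq0 s1 oner_eq0.
have g_gt0 : 0 < g by apply: tr_gram_inv_gt0.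
have g_neq0 : g != 0 by rewrite gt_eqF.
have ss1 : s^T *m s = 1%:M.
  by rewrite [LHS]mx11_scalar -sqr_enorm s1 expr1n.
have su : s^T *m (g^-1 *: u) = 1%:M.
  by rewrite -scalemxAr [_ *m _]mx11_scalar -/g scale_scalar_mx mulVf.
exists g^-1; first by rewrite invr_gt0.
(* The coefficient vectors of [z] and of the candidate [g^-1 *: (C *m u)] both have inner product 1
   with [s], so their difference [d] is orthogonal to [s]. *)
pose d := s + w - g^-1 *: u.
have sd0 : s^T *m d = 0 by rewrite mulmxBr mulmxDr sw0 ss1 su addr0 subrr.
have zD : z = C *m d + g^-1 *: (C *m u).
  by rewrite scalemxAr -mulmxDr subrK mulmxDr.
have orth : (C *m d)^T *m (g^-1 *: (C *m u)) = 0.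
  by rewrite -scalemxAr mulmx_gram_inv -[s]trmxK -trmx_mul sd0 trmx0 scaler0.
have yT : tangent_space C (C *m s) (g^-1 *: (C *m u)).
  exists s, (g^-1 *: u - s); split=> //; first by rewrite mulmxBr su ss1 subrr.
  by rewrite -mulmxDr addrC subrK scalemxAr.
(* Comparing squared norms with the candidate, Pythagoras leaves [enorm (C *m d) ^+ 2 <= 0], so [z]
   is the candidate. *)
have := zmin _ yT; rewrite -(@ler_pXn2r _ 2) ?nnegrE ?enorm_ge0 // zD.
rewrite sqr_enormD_orth // gerDr => Cd_le0.
have : enorm (C *m d) ^+ 2 == 0 by rewrite eq_le Cd_le0 sqr_ge0.
by rewrite expf_eq0 /= enorm_eq0 => /eqP ->; rewrite add0r.
Qed.

(** Injectivity of [C] makes the unit coefficient vector of [y] equal to [(c / a) *: v]; since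
    [c / a] is positive, the unit norm determines it, whatever [c] is. *)
Lemma retraction_pos_multiple (c : R) (v : 'cV[R]_q) (y : 'cV[R]_p) :
  0 < c -> is_retraction C (c *: (C *m v)) y -> y = (1 / enorm v) *: (C *m v).
Proof.
move=> c_gt0 [[t t1 <-] [a a_gt0]]; rewrite !scalemxAr => /mulmx_full_col_inj cv.
have tE : t = (c / a) *: v.
  by rewrite mulrC -scalerA cv scalerA mulVf ?scale1r ?gt_eqF.
congr (C *m _); rewrite {1}tE; congr (_ *: v).
have b_gt0 : 0 < c / a by rewrite divr_gt0.
move: t1; rewrite /= tE enormZ gtr0_norm // => bv1.
(* Dividing by [enorm v] is legitimate: were it zero, its product with [c / a] could not be 1. *)
rewrite -bv1 mulfK //; apply: contra_eq_neq bv1 => ->.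
by rewrite mulr0 eq_sym oner_eq0.
Qed.

Lemma tangent_retraction_step (f z y : 'cV[R]_p) :
    ellipsoid C f -> min_norm_vector (tangent_space C f) z ->
    is_retraction C z y ->
  y = (1 / enorm (invmx A *m (pinv C *m f))) *:
        (C *m (invmx A *m (pinv C *m f))).
Proof.
case=> s s1 <- zmin; rewrite [pinv C *m _]mulmxA pinv_full_colK mul1mx.
have [c c_gt0 ->] := min_norm_tangent_space s1 zmin.
exact: retraction_pos_multiple.
Qed.

End FullColumnRank.

Theorem mainTheorem2 (R : realType) (p q : nat) (C : 'M[R]_(p, q))
    (hC : \rank C = q) (f0 : 'cV[R]_p) (hf0 : ellipsoid C f0)
    (f : nat -> 'cV[R]_p) (hf : tangent_retraction_seq C f0 f) :
  let s := fun k => pinv C *m f k in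
  let beta := fun k => 1 / enorm (invmx (C^T *m C) *m s k) in
  forall k : nat,
    s k.+1 = beta k *: (invmx (C^T *m C) *m s k) /\
    f k.+1 = beta k *: (pinv (C *m C^T) *m f k).
Proof.
move=> s beta k; case: hf => f00 step.
(* Every later iterate is a retraction, hence lies on the ellipsoid. *)
have fE j : ellipsoid C (f j).
  by case: j => [|j]; [rewrite f00 | have [z _ []] := step j].
have [z zmin zret] := step k.
have fS := tangent_retraction_step hC (fE k) zmin zret.
split.
  by rewrite /s fS -scalemxAr (mulmxA _ C) pinv_full_colK ?mul1mx.
(* Both sides reduce to the same multiple of [C *m invmx A *m invmx A *m C^T *m f k]. *)
by rewrite fS pinv_mulmx_tr // /beta /s pinv_full_col // !mulmxA.
Qed.
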